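(* Let $\{x^k\}$ be generated by the coordinate descent algorithm described in the context. Suppose that: (A) there exists $L>0$ such that, for every iteration $k$ and every trial point $z=z^{\mathrm{trial}}$ computed at iteration $k$, $$\|\nabla f_k(z)-\nabla M_k(z)\|\le L\|z-\bar x^k\|^p,\qquad M_k(\bar x^k)=f_k(\bar x^k),\qquad f_k(z)\le M_k(z)+L\|z-\bar x^k\|^{p+1};$$ (B) there exists a positive integer $\bar m<+\infty$ such that, for all $i\in\{1,\dots,n\}$: there exists $k<\bar m$ with $i\in I_k$; and for any $k\in\mathbb{N}$, if $i\in I_k$ then there exists $1\le m\le\bar m$ with $i\in I_{k+m}$; (C) there exists $L_g>0$ such that $|[g_P(x)]_i-[g_P(z)]_i|\le L_g\|x-z\|$ for all $i=1,\dots,n$ and all $x,z\in\Omega$. Let $f_{\mathrm{target}}\le f(x^0)$ and $\varepsilon>0$ be given. Then there exists a cycle (block of $\bar m$ consecutive iterations, see context) of index not larger than $$\frac{f(x^0)-f_{\mathrm{target}}}{c\,(\varepsilon/2)^{(p+1)/p}}+\frac{f(x^0)-f_{\mathrm{target}}}{\alpha\,\big(\varepsilon/(2\bar m L_g)\big)^{p+1}}+1,$$ where $c>0$ only depends on $\alpha,\tau_2,L,p$ and $\theta$, such that, in its first internal iteration $k$, either $f(x^k)\le f_{\mathrm{target}}$ or $$|[g_P(x^{k+1})]_i|\le\varepsilon\quad\text{for all } i=1,\dots,n.$$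
   Context: $\|\cdot\|$ is the Euclidean norm. Let $\Omega=\{x\in\mathbb{R}^n:\ell\le x\le u\}$ with $\ell,u\in\mathbb{R}^n$, $\ell<u$ componentwise, and let $f$ have continuous first derivatives over $\Omega$. $P_C$ denotes Euclidean projection onto a closed convex set $C$; $g(x)=\nabla f(x)$ and $g_P(x)=P_\Omega(x-g(x))-x$. For $v\in\mathbb{R}^n$ and $I\subseteq\{1,\dots,n\}$, $v_I\in\mathbb{R}^{|I|}$ is the subvector of components with indices in $I$. Coordinate descent algorithm. Given: $p\in\{1,2,3,\dots\}$, $\alpha>0$, $\sigma_{\min}>0$, $\tau_2\ge\tau_1>1$, $\theta>0$, $x^0\in\Omega$. At each iteration $k=0,1,2,\dots$: choose a nonempty $I_k\subseteq\{1,\dots,n\}$. For $z\in\mathbb{R}^{|I_k|}$ let $x^k[z]$ be the vector with $(x^k[z])_{I_k}=z$ and $(x^k[z])_i=x^k_i$ for $i\notin I_k$. Put $f_k(z)=f(x^k[z])$, $\Omega_k=\{z\in\mathbb{R}^{|I_k|}:\ell_{I_k}\le z\le u_{I_k}\}$, $\bar x^k=x^k_{I_k}$, and let $M_k:\mathbb{R}^{|I_k|}\to\mathbb{R}$ be a model of $f_k$ around $\bar x^k$ whose gradient exists on $\Omega_k$. Step 1: set $\sigma\leftarrow 0$. Step 2: compute a trial point $z^{\mathrm{trial}}\in\Omega_k$ with $M_k(z^{\mathrm{trial}})+\sigma\|z^{\mathrm{trial}}-\bar x^k\|^{p+1}\le M_k(\bar x^k)$ and $$\Big\|P_{\Omega_k}\big[z^{\mathrm{trial}}-\nabla\big(M_k(z)+\sigma\|z-\bar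 x^k\|^{p+1}\big)\big|_{z=z^{\mathrm{trial}}}\big]-z^{\mathrm{trial}}\Big\|\le\theta\|z^{\mathrm{trial}}-\bar x^k\|^p.$$ Step 3: if $f_k(z^{\mathrm{trial}})\le f_k(\bar x^k)-\alpha\|z^{\mathrm{trial}}-\bar x^k\|^{p+1}$, accept it: set $x^{k+1}=x^k[z^{\mathrm{trial}}]$, $\sigma_k=\sigma$, and go to iteration $k+1$. Otherwise set $\sigma\leftarrow\max\{\sigma_{\min},\tau\sigma\}$ with some $\tau\in[\tau_1,\tau_2]$ and return to Step 2. Cycles: for $\ell=0,1,2,\dots$ (here $\ell$ is an integer index), the internal iterations of cycle $\ell$ are $k=\ell\bar m,\ell\bar m+1,\dots,\ell\bar m+\bar m-1$; the first internal iteration is $k=\ell\bar m$.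
   Formalization: The constant c may also depend on an upper bound s for σ_min (σ_min ≤ s); without one the claim fails for large σ_min, which forces tiny steps. For σ_min ≤ τ_2(L+α) one may take s = τ_2(L+α), so c depends only on α, τ_2, L, p, θ as stated. *)

(* Defs.v *)
From HB Require Import structures.
From mathcomp Require Import all_boot all_order all_algebra.
From mathcomp Require Import all_classical all_reals all_analysis.

Set Implicit Arguments.
Unset Strict Implicit.
Unset Printing Implicit Defensive.

Import Order.TTheory GRing.Theory Num.Theory.
Import numFieldNormedType.Exports.

Local Open Scope classical_set_scope.
Local Open Scope ring_scope.

(* The norm [`|v|] that the library puts on ['rV[R]_n] is the sup norm; the
   Euclidean norm has to be defined separately. The two induce the same
   topology, so the library notions of continuity can be used unchanged. *)
Definition enorm (R : realType) (n : nat) (v : 'rV[R]_n) : R :=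
  Num.sqrt (\sum_(i < n) v 0 i ^+ 2).

Definition box (R : realType) (n : nat) (l u : 'rV[R]_n) : set 'rV[R]_n :=
  [set x | forall i, l 0 i <= x 0 i <= u 0 i].

Definition is_proj (R : realType) (n : nat) (C : set 'rV[R]_n)
    (x y : 'rV[R]_n) : Prop :=
  C y /\ forall w, C w -> enorm (x - y) <= enorm (x - w).

(* When [C] is closed, convex and nonempty, [is_proj C x] holds at exactly one
   point; the default value [0] is irrelevant there. *)
Definition proj (R : realType) (n : nat) (C : set 'rV[R]_n)
    (x : 'rV[R]_n) : 'rV[R]_n :=
  xget 0 (is_proj C x).

(* Only the existence of the partial derivatives is required, which is implied
   by Frechet differentiability. They are two-sided, also at boundary points of
   a box. *)
Definition has_grad (R : realType) (n : nat) (f : 'rV[R]_n -> R)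
    (x : 'rV[R]_n) : Prop :=
  forall i, derivable f x (delta_mx 0 i).

Definition grad (R : realType) (n : nat) (f : 'rV[R]_n -> R)
    (x : 'rV[R]_n) : 'rV[R]_n :=
  \row_i 'D_(delta_mx 0 i) f x.

Definition continuous_first_derivatives (R : realType) (n : nat)
    (C : set 'rV[R]_n) (f : 'rV[R]_n -> R) : Prop :=
  (forall x, C x -> has_grad f x) /\
  forall i, {within C, continuous (fun x => grad f x 0 i)}.

Definition gP (R : realType) (n : nat) (l u : 'rV[R]_n) (f : 'rV[R]_n -> R)
    (x : 'rV[R]_n) : 'rV[R]_n :=
  proj (box l u) (x - grad f x) - x.

(* Vectors indexed by a set [I] of indices are row vectors of length [#|I|],
   the indices in [I] being listed in increasing order by [enum_val]. *)
Definition subvec (R : realType) (n : nat) (I : {set 'I_n})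
    (v : 'rV[R]_n) : 'rV[R]_#|I| :=
  \row_j v 0 (enum_val j).

(* The vector x[z]: [z] on the indices in [I], [x] elsewhere. *)
Definition replace (R : realType) (n : nat) (I : {set 'I_n})
    (x : 'rV[R]_n) (z : 'rV[R]_#|I|) : 'rV[R]_n :=
  \row_i (if [pick j : 'I_#|I| | enum_val j == i] is Some j
          then z 0 j else x 0 i).

(* A run of coordinate descent. At iteration [k], [trial k j] is the trial point
   computed for the regularization parameter [sigma k j]; the trial points
   computed are those with [j <= nrej k], and all but the last are rejected.
   Entries with [j > nrej k] are meaningless. *)
Record cd_run (R : realType) (n : nat) := CDRun {
  iterate : nat -> 'rV[R]_n;
  block : nat -> {set 'I_n};
  model : forall k, 'rV[R]_#|block k| -> R;
  nrej : nat -> nat;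
  sigma : nat -> nat -> R;
  trial : forall k, nat -> 'rV[R]_#|block k| }.

Arguments model {R n} _ _ _.
Arguments trial {R n} _ _ _.

Section Run.
Variables (R : realType) (n : nat) (f : 'rV[R]_n -> R) (l u : 'rV[R]_n).
Variable r : cd_run R n.

Definition block_box (k : nat) : set 'rV[R]_#|block r k| :=
  box (subvec (block r k) l) (subvec (block r k) u).

Definition block_fun (k : nat) (z : 'rV[R]_#|block r k|) : R :=
  f (replace (iterate r k) z).

Definition xbar (k : nat) : 'rV[R]_#|block r k| :=
  subvec (block r k) (iterate r k).

Definition reg_model (p k : nat) (s : R) (z : 'rV[R]_#|block r k|) : R :=
  model r k z + s * enorm (z - xbar k) ^+ p.+1.

Definition valid_trial (p : nat) (theta : R) (k : nat) (s : R)
    (z : 'rV[R]_#|block r k|) : Prop :=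
  [/\ @block_box k z,
      reg_model p s z <= model r k (xbar k) &
      enorm (proj (@block_box k) (z - grad (@reg_model p k s) z) - z)
        <= theta * enorm (z - xbar k) ^+ p].

Definition sufficient_decrease (p : nat) (alpha : R) (k : nat)
    (z : 'rV[R]_#|block r k|) : bool :=
  block_fun z <= block_fun (xbar k) - alpha * enorm (z - xbar k) ^+ p.+1.

Definition cd_iteration (p : nat) (alpha sigma_min tau1 tau2 theta : R)
    (k : nat) : Prop :=
  [/\ block r k != finset.set0,
      forall z, @block_box k z -> has_grad (model r k) z &
      [/\ sigma r k 0 = 0,
      forall j, (j <= nrej r k)%N ->
        valid_trial p theta (sigma r k j) (trial r k j),
      forall j, (j < nrej r k)%N ->
        ~~ sufficient_decrease p alpha (trial r k j) /\
        exists2 tau, tau1 <= tau <= tau2 &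
          sigma r k j.+1 = Num.max sigma_min (tau * sigma r k j),
      sufficient_decrease p alpha (trial r k (nrej r k)) &
      iterate r k.+1 = replace (iterate r k) (trial r k (nrej r k))]].

Definition generated (p : nat) (alpha sigma_min tau1 tau2 theta : R)
    (x0 : 'rV[R]_n) : Prop :=
  [/\ box l u x0, iterate r 0 = x0 &
      forall k, cd_iteration p alpha sigma_min tau1 tau2 theta k].

Definition model_accuracy (p : nat) (L : R) : Prop :=
  forall k j, (j <= nrej r k)%N ->
    let z := trial r k j in
    [/\ enorm (grad (@block_fun k) z - grad (model r k) z)
          <= L * enorm (z - xbar k) ^+ p,
        model r k (xbar k) = block_fun (xbar k) &
        block_fun z <= model r k z + L * enorm (z - xbar k) ^+ p.+1].

Definition essentially_cyclic (m : nat) : Prop :=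
  forall i : 'I_n,
    (exists2 k, (k < m)%N & i \in block r k) /\
    (forall k, i \in block r k ->
       exists2 m', (1 <= m' <= m)%N & i \in block r (k + m')).

End Run.

(* Main.v *)
(* A rejected trial has sigma < L + alpha, so the accepted sigma is at most
   max(s, tau2 (L + alpha)). Since projecting onto a box is a componentwise,
   nonexpansive operation, the stopping test then gives
   |g_P(x^{k+1})_i| <= C d_k^p for i in I_k, where d_k = |x^{k+1} - x^k|.
   Suppose |g_P(x^{k+1})_i| > eps at the first iteration of a cycle, and let k'
   be an iteration of that cycle with i in I_{k'}. Either some step of the cycle
   exceeds eps / (2 m L_g), or g_P drifts by at most eps / 2 up to k' and so
   C d_{k'}^p >= eps / 2. In each case f decreases over the cycle by one of the
   two denominators of the bound, which can happen only so many times before f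
   reaches f_target. *)

Require Import Defs.
From HB Require Import structures.
From mathcomp Require Import all_boot all_order all_algebra.
From mathcomp Require Import all_classical all_reals all_analysis.
From mathcomp Require Import ring lra.

Set Implicit Arguments.
Unset Strict Implicit.
Unset Printing Implicit Defensive.

Import Order.TTheory GRing.Theory Num.Theory.
Import numFieldNormedType.Exports.

Local Open Scope classical_set_scope.
Local Open Scope ring_scope.

(** * The Euclidean norm on row vectors *)

Section EuclideanNorm.
Variables (R : realType) (n : nat).
Implicit Types v w : 'rV[R]_n.

Lemma enorm_ge0 v : 0 <= enorm v.
Proof. exact: sqrtr_ge0. Qed.

Lemma enorm_sqr v : enorm v ^+ 2 = \sum_(i < n) v 0 i ^+ 2.
Proof. by rewrite sqr_sqrtr// sumr_ge0// => i _; exact: sqr_ge0. Qed.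

Lemma enorm_le v w : (forall i, `|v 0 i| <= `|w 0 i|) -> enorm v <= enorm w.
Proof.
move=> vw; apply: ler_wsqrtr; apply: ler_sum => i _.
by rewrite -(real_normK (num_real (v 0 i))) -(real_normK (num_real (w 0 i)))
  ler_sqr ?nnegrE.
Qed.

Lemma ler_coord_enorm v i : `|v 0 i| <= enorm v.
Proof.
rewrite -sqrtr_sqr ler_wsqrtr// (bigD1 i)//= lerDl.
by apply: sumr_ge0 => j _; exact: sqr_ge0.
Qed.

Lemma enorm_eq0 v : enorm v = 0 -> v = 0.
Proof.
move=> v0; apply/rowP => i; rewrite mxE; apply/eqP.
by rewrite -normr_le0 -v0 ler_coord_enorm.
Qed.

Lemma enorm0 : enorm (0 : 'rV[R]_n) = 0.
Proof.
by apply/eqP; rewrite sqrtr_eq0 big1// => i _; rewrite mxE expr0n.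
Qed.

Lemma enormZ a v : enorm (a *: v) = `|a| * enorm v.
Proof.
rewrite /enorm -sqrtr_sqr -sqrtrM ?sqr_ge0//; congr Num.sqrt.
by rewrite mulr_sumr; apply: eq_bigr => i _; rewrite mxE exprMn.
Qed.

(** With [a] and [b] the two norms, the sum of the squares of [b * v 0 i - a * w 0 i] equals [2ab]
    times the gap between the two sides. Dividing by [2ab] requires both norms to be nonzero, hence
    the two degenerate cases first. *)
Lemma cauchy_schwarz_row v w :
  \sum_(i < n) v 0 i * w 0 i <= enorm v * enorm w.
Proof.
have [/enorm_eq0 ->|v0] := eqVneq (enorm v) 0.
  by rewrite enorm0 mul0r big1// => i _; rewrite mxE mul0r.
have [/enorm_eq0 ->|w0] := eqVneq (enorm w) 0.
  by rewrite enorm0 mulr0 big1// => i _; rewrite mxE mulr0.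
set a := enorm v in v0 *; set b := enorm w in w0 *.
have a0 : 0 < a by rewrite lt_def v0 enorm_ge0.
have b0 : 0 < b by rewrite lt_def w0 enorm_ge0.
have h : 0 <= \sum_(i < n) (b * v 0 i - a * w 0 i) ^+ 2.
  by apply: sumr_ge0 => i _; exact: sqr_ge0.
have e : \sum_(i < n) (b * v 0 i - a * w 0 i) ^+ 2 =
    2 * (a * b) * (a * b - \sum_(i < n) v 0 i * w 0 i).
  transitivity (\sum_(i < n) (b ^+ 2 * v 0 i ^+ 2 + a ^+ 2 * w 0 i ^+ 2
      - 2 * (a * b) * (v 0 i * w 0 i))).
    by apply: eq_bigr => i _; ring.
  by rewrite sumrB big_split/= -!mulr_sumr -!enorm_sqr -/a -/b; ring.
by move: h; rewrite e pmulr_rge0 ?subr_ge0// !mulr_gt0.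
Qed.

Lemma ler_enormD v w : enorm (v + w) <= enorm v + enorm w.
Proof.
rewrite -ler_sqr ?nnegrE ?addr_ge0 ?enorm_ge0// sqrrD !enorm_sqr.
under eq_bigr do rewrite mxE sqrrD.
rewrite !big_split/= lerD2r lerD2l.
by rewrite mulr2n lerD ?cauchy_schwarz_row.
Qed.

Lemma enormN v : enorm (- v) = enorm v.
Proof. by rewrite -scaleN1r enormZ normrN1 mul1r. Qed.

End EuclideanNorm.

(** * Projection onto an interval and onto a box *)

Definition clamp (R : realType) (a b x : R) : R := Num.max a (Num.min b x).

Lemma clamp_itv (R : realType) (a b x : R) :
  a <= b -> a <= clamp a b x <= b.
Proof. by move=> ab; rewrite le_max lexx/= ge_max ab ge_min lexx. Qed.

(* The angle at the projection is obtuse. *)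
Lemma clamp_pythagoras (R : realType) (a b x y : R) : a <= y <= b ->
  (x - clamp a b x) ^+ 2 + (y - clamp a b x) ^+ 2 <= (x - y) ^+ 2.
Proof.
move=> /andP[ay yb]; rewrite /clamp /Num.max /Num.min.
by case: (ltP b x) => ?; case: ltP => ?; nra.
Qed.

Lemma clamp_nonexpansive (R : realType) (a b x y : R) :
  `|clamp a b x - clamp a b y| <= `|x - y|.
Proof.
rewrite ler_norml; apply/andP; split; have := lerNnormlW (lexx `|x - y|);
  have := ler_norm (x - y); rewrite /clamp /Num.max /Num.min;
  by case: (ltP b x) => ?; case: (ltP b y) => ?; case: ltP => ?; case: ltP => ?; lra.
Qed.

(** Summing [clamp_pythagoras] over the coordinates gives [key], which yields both the minimality of
    the clamped point and its uniqueness. *)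
Lemma proj_boxE (R : realType) (n : nat) (l u x : 'rV[R]_n) :
  (forall i, l 0 i <= u 0 i) ->
  Defs.proj (box l u) x = \row_i clamp (l 0 i) (u 0 i) (x 0 i).
Proof.
move=> lu; set c := \row_i _.
have cbox : box l u c by move=> i; rewrite mxE; exact: clamp_itv.
have key w : box l u w -> enorm (x - c) ^+ 2 + enorm (w - c) ^+ 2
    <= enorm (x - w) ^+ 2.
  move=> bw; rewrite !enorm_sqr -big_split/=; apply: ler_sum => i _.
  by rewrite !mxE; apply: clamp_pythagoras.
apply: xget_unique.
  split=> // w bw; rewrite -ler_sqr ?nnegrE ?enorm_ge0//.
  by apply: le_trans (key _ bw); rewrite lerDl sqr_ge0.
(* Another minimizer [y] is no farther from [x] than [c] is, so [key] at [y] leaves no room for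
   [enorm (y - c) ^+ 2]. *)
move=> y [ybox /(_ _ cbox)]; rewrite -ler_sqr ?nnegrE ?enorm_ge0// => yc.
have := le_trans (key _ ybox) yc; rewrite gerDl => yc0.
apply: subr0_eq; apply: enorm_eq0; apply/eqP.
by rewrite -sqrf_eq0 eq_le yc0 sqr_ge0.
Qed.

Lemma proj_box_nonexpansive (R : realType) (n : nat) (l u x y : 'rV[R]_n) :
  (forall i, l 0 i <= u 0 i) ->
  enorm (Defs.proj (box l u) x - Defs.proj (box l u) y) <= enorm (x - y).
Proof.
move=> lu; rewrite !proj_boxE//; apply: enorm_le => i.
by rewrite !mxE; exact: clamp_nonexpansive.
Qed.

(** * Partial derivatives of powers of the norm *)

Lemma derive_line (R : realType) (V : normedModType R) (f : V -> R) (x v : V) :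
  'D_v f x = 'D_1 (fun h : R => f (h *: v + x)) 0.
Proof.
rewrite /derive; set g1 := fun h => h^-1 *: _; set g2 := fun h => h^-1 *: _.
suff -> : g1 = g2 by [].
apply/funext => h; rewrite /g1 /g2 /=.
by rewrite addr0 scale0r add0r [_%:A]mulr1.
Qed.

Lemma is_derive_line (R : realType) (V : normedModType R) (f : V -> R)
    (x v : V) (d : R) :
  is_derive (0 : R) (1 : R) (fun h : R => f (h *: v + x)) d -> is_derive x v f d.
Proof.
by move=> [dx e]; split; [exact/derivable1P|rewrite derive_line].
Qed.

Lemma enorm_line (R : realType) (n : nat) (v : 'rV[R]_n) i (h : R) :
  enorm (h *: delta_mx 0 i + v) =
  Num.sqrt (enorm v ^+ 2 + (2 * v 0 i * h + h ^+ 2)).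
Proof.
rewrite enorm_sqr /enorm; congr Num.sqrt.
rewrite (bigD1 i)//= [in RHS](bigD1 i)//= !mxE !eqxx/=.
under eq_bigr => j ji do rewrite !mxE eqxx (negPf ji)/= mulr0 add0r.
by ring.
Qed.

(** Along a coordinate line the squared norm is the quadratic [q], and the chain rule with the
    square root applies when [q 0] is positive. At [z = a] the square root is not differentiable,
    and the difference quotient is treated directly. *)
Lemma is_derive_enormX (R : realType) (n p : nat) (a z : 'rV[R]_n) i :
  (0 < p)%N ->
  is_derive z (delta_mx 0 i) (fun y => enorm (y - a) ^+ p.+1)
    (p.+1%:R * enorm (z - a) ^+ p.-1 * (z - a) 0 i).
Proof.
move=> p0; apply: is_derive_line.
set w := z - a; set d := enorm w.
pose q := fun h : R => d ^+ 2 + (2 * w 0 i * h + h ^+ 2).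
have -> : (fun h : R => enorm (h *: delta_mx 0 i + z - a) ^+ p.+1) =
    (Num.sqrt \o q) ^+ p.+1.
  by apply/funext => h; rewrite -addrA enorm_line exprfctE.
have [d0|d0] := eqVneq d 0.
  have w0 : w = 0 by exact: enorm_eq0.
  (* The quotient has absolute value [|h| ^+ p], which is at most [|h|] for [|h| < 1] because
     [0 < p]. *)
  have cv : h^-1 *: ((((Num.sqrt \o q) ^+ p.+1) \o shift 0) (h *: 1)
      - ((Num.sqrt \o q) ^+ p.+1) 0) @[h --> (0 : R)^'] --> (0 : R).
    apply/cvgr0Pnorm_lt => e e0; near=> h.
    rewrite !exprfctE /= /q d0 w0 !mxE !(mulr0, mul0r, expr0n, add0r, addr0)/=.
    rewrite sqrtr0 expr0n/= subr0 [h *: 1]mulr1 sqrtr_sqr exprS.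
    have h0 : h != 0 by near: h; exact: nbhs_dnbhs_neq.
    rewrite [_ *: _]/(_ * _) normrM normfV normrM normr_id mulKf ?normr_eq0//.
    rewrite normrX normr_id -(prednK p0) exprS.
    have h1 : `|h| < 1 by near: h; apply: dnbhs0_lt.
    have he : `|h| < e by near: h; apply: dnbhs0_lt.
    apply: le_lt_trans he; rewrite ler_piMr// exprn_ile1//; exact: ltW.
  rewrite w0 mxE mulr0; split; first by apply/cvg_ex; exists 0.
  exact: cvg_lim cv.
have dpos : 0 < d by rewrite lt_def d0 enorm_ge0.
have q0 : q 0 = d ^+ 2 by rewrite /q mulr0 expr0n/= !addr0.
have dq : is_derive (0 : R) (1 : R) q (2 * w 0 i).
  have -> : q = cst (d ^+ 2) + ((2 * w 0 i) \*: id + id ^+ 2).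
    by apply/funext => h; rewrite /q /= !fctE.
  apply: is_derive_eq (is_deriveD (is_derive_cst _ _ _)
    (is_deriveD (is_deriveZ _ (is_derive_id _ _))
                (is_deriveX 2 (is_derive_id _ _)))) _.
  change (0 + (2 * w 0 i * 1 + 2%:R * 0 * 1) = 2 * w 0 i :> R).
  by rewrite mulr0 mul0r mulr1 add0r addr0.
have ds : is_derive (q 0) 1 Num.sqrt (2 * d)^-1.
  have := @is_derive1_sqrt R (q 0).
  by rewrite q0 sqrtr_sqr gtr0_norm//; apply; rewrite exprn_gt0.
have dc := is_derive1_comp ds dq.
apply: is_derive_eq (is_deriveX p.+1 dc) _.
rewrite /= q0 sqrtr_sqr gtr0_norm// -[p in LHS](prednK p0)/= exprS.
rewrite prednK//.
change (p.+1%:R * (d * d ^+ p.-1) * ((2 * d)^-1 * (2 * w 0 i)) =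
  p.+1%:R * d ^+ p.-1 * w 0 i).
by field.
Unshelve. all: by end_near. Qed.

(** * Coordinate blocks: lines, norms, gradients and projections *)

Section Blocks.
Variables (R : realType) (n : nat) (I : {set 'I_n}).
Implicit Types (x v : 'rV[R]_n) (z : 'rV[R]_#|I|).

Lemma replace_in x z j : replace x z 0 (enum_val j) = z 0 j.
Proof.
rewrite mxE; case: pickP => [j' /eqP/enum_val_inj -> //|/(_ j)].
by rewrite eqxx.
Qed.

Lemma replace_notin x z i : i \notin I -> replace x z 0 i = x 0 i.
Proof.
move=> iI; rewrite mxE; case: pickP => // j /eqP ji.
by move: iI; rewrite -ji enum_valP.
Qed.

Lemma rowP_block x v :
  (forall j : 'I_#|I|, x 0 (enum_val j) = v 0 (enum_val j)) ->
  (forall i, i \notin I -> x 0 i = v 0 i) -> x = v.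
Proof.
move=> xvI xvC; apply/rowP => i; have [iI|/xvC //] := boolP (i \in I).
by rewrite -(enum_rankK_in iI iI) xvI.
Qed.

Lemma replace_subvec x : replace x (subvec I x) = x.
Proof.
apply: rowP_block => [j|i iI]; last exact: replace_notin.
by rewrite replace_in mxE.
Qed.

Lemma replace_line x z j (h : R) :
  replace x (h *: delta_mx 0 j + z) =
  h *: delta_mx 0 (enum_val j) + replace x z.
Proof.
apply: rowP_block => [k|i iI].
  rewrite replace_in [LHS]mxE [RHS]mxE replace_in; congr (_ + _).
  by rewrite !mxE !eqxx (inj_eq enum_val_inj).
rewrite replace_notin// [RHS]mxE replace_notin// !mxE eqxx.
rewrite (_ : i == enum_val j = false) ?mulr0 ?add0r//.
by apply: contraNF iI => /eqP ->; exact: enum_valP.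
Qed.

Lemma enorm_replace x z : enorm (replace x z - x) = enorm (z - subvec I x).
Proof.
congr Num.sqrt; rewrite (bigID (mem I))/= [X in _ + X]big1 ?addr0.
  rewrite big_enum_val/=.
  by apply: eq_bigr => j _; rewrite [in LHS]mxE replace_in !mxE.
by move=> i iI; rewrite mxE replace_notin// mxE subrr expr0n.
Qed.

Lemma box_replace (l u : 'rV[R]_n) x z : box l u x ->
  box (subvec I l) (subvec I u) z -> box l u (replace x z).
Proof.
move=> bx bz i; have [iI|iI] := boolP (i \in I); last by rewrite replace_notin.
by rewrite -(enum_rankK_in iI iI) replace_in; have := bz (enum_rank_in iI i);
  rewrite !mxE.
Qed.

(** By [replace_line], corresponding partial derivatives are derivatives of the same function of one
    variable. *)
Lemma grad_replace (f : 'rV[R]_n -> R) x z :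
  grad (fun y : 'rV[R]_#|I| => f (replace x y)) z =
  subvec I (grad f (replace x z)).
Proof.
apply/rowP => j; rewrite [LHS]mxE [RHS]mxE [RHS]mxE derive_line [RHS]derive_line.
suff -> : (fun h : R => f (replace x (h *: delta_mx 0 j + z))) =
    (fun h => f (h *: delta_mx 0 (enum_val j) + replace x z)) by [].
by apply/funext => h; rewrite replace_line.
Qed.

(** Projection onto a box acts coordinate by coordinate, so it commutes with restriction to a
    block. *)
Lemma proj_grad_replace (l u : 'rV[R]_n) (f : 'rV[R]_n -> R) x z :
  (forall i, l 0 i <= u 0 i) ->
  Defs.proj (box (subvec I l) (subvec I u))
    (z - grad (fun y : 'rV[R]_#|I| => f (replace x y)) z) - z =
  subvec I (gP l u f (replace x z)).
Proof.
move=> lu; rewrite /gP grad_replace !proj_boxE//; last by move=> j; rewrite !mxE.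
apply/rowP => j; move: (replace_in x z j); move: (replace x z) => y yz.
by rewrite !mxE yz.
Qed.

End Blocks.

(** * Estimates along a run of the algorithm *)

Section Run.
Variables (R : realType) (n : nat) (f : 'rV[R]_n -> R) (l u : 'rV[R]_n).
Variables (r : cd_run R n) (p : nat) (alpha sigma_min tau1 tau2 theta L : R).
Hypotheses (p_gt0 : (0 < p)%N) (alpha_gt0 : 0 < alpha) (L_gt0 : 0 < L).
Hypothesis lu : forall i, l 0 i < u 0 i.
Hypotheses (sigma_min_gt0 : 0 < sigma_min) (tau1_gt1 : 1 < tau1).
Hypothesis tau12 : tau1 <= tau2.
Hypothesis itP :
  forall k, cd_iteration f l u r p alpha sigma_min tau1 tau2 theta k.
Hypothesis accurate : model_accuracy f r p L.

Definition sigma_max (s : R) := Num.max s (tau2 * (L + alpha)).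

Lemma sigma_max_ge0 s : 0 <= sigma_max s.
Proof.
rewrite le_max; apply/orP; right; rewrite mulr_ge0 ?addr_ge0 ?ltW//.
by rewrite (lt_le_trans _ tau12)// (lt_trans _ tau1_gt1).
Qed.

(** With [d] the trial step length, model decrease and accuracy give
    [f(z) <= f(xbar) - (sigma - L) d^(p+1)]; thus [sigma >= L + alpha] would force acceptance. *)
Lemma sigma_rejected k j : (j < nrej r k)%N -> sigma r k j < L + alpha.
Proof.
move=> jk; have [_ _ [_ vt rej _ _]] := itP k.
have [_ + _] := vt _ (ltnW jk); have [+ _] := rej _ jk.
rewrite /sufficient_decrease /reg_model -ltNge.
have [_ -> +] := accurate (ltnW jk).
have := enorm_ge0 (trial r k j - xbar r k).
by move=> /(exprn_ge0 p.+1); nra.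
Qed.

(** Each update yields either [sigma_min], which is at most [s], or at most [tau2] times a rejected
    value. Bounding through [s] keeps [sigma_min] out of the final constant. *)
Lemma sigma_bound s k j : sigma_min <= s -> (j <= nrej r k)%N ->
  0 <= sigma r k j <= sigma_max s.
Proof.
move=> smin; elim: j => [_|j ih jk].
  by have [_ _ [-> _ _ _ _]] := itP k; rewrite lexx sigma_max_ge0.
have [_ _ [_ _ rej _ _]] := itP k.
have [_ [tau /andP[t1 t2] ->]] := rej _ jk.
have /andP[s0 _] := ih (ltnW jk).
rewrite le_max (ltW sigma_min_gt0)/= ge_max !le_max smin/=.
apply/orP; right; apply: ler_pM => //; last exact/ltW/sigma_rejected.
by rewrite (le_trans _ t1)// (le_trans _ (ltW tau1_gt1)).
Qed.

Lemma grad_reg_model k (s : R) z : block_box l u z ->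
  grad (@reg_model _ _ r p k s) z = grad (model r k) z
    + (s * (p.+1%:R * enorm (z - xbar r k) ^+ p.-1)) *: (z - xbar r k).
Proof.
move=> bz; have [_ hg _] := itP k; apply/rowP => i; rewrite !mxE.
have dM := hg _ bz i.
have dN := is_derive_enormX (xbar r k) z i p_gt0.
have -> : @reg_model _ _ r p k s =
    model r k + s \*: (fun y => enorm (y - xbar r k) ^+ p.+1).
  by apply/funext => y.
rewrite deriveD// deriveZ// [in X in _ + X]derive_val !mxE.
by rewrite [LHS]/(_ + _ * _) !mulrA.
Qed.

Lemma iterate_box k : box l u (iterate r 0) -> box l u (iterate r k).
Proof.
move=> b0; elim: k => // k ih; have [_ _ [_ vt _ _ ->]] := itP k.
by apply: box_replace => //; have [] := vt _ (leqnn _).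
Qed.

Definition step k := enorm (iterate r k.+1 - iterate r k).

Lemma stepE k : step k = enorm (trial r k (nrej r k) - xbar r k).
Proof. by have [_ _ [_ _ _ _ itS]] := itP k; rewrite /step itS enorm_replace. Qed.

Lemma step_ge0 k : 0 <= step k.
Proof. exact: enorm_ge0. Qed.

Lemma decrease k : f (iterate r k.+1) <= f (iterate r k) - alpha * step k ^+ p.+1.
Proof.
rewrite stepE; have [_ _ [_ _ _ sd ->]] := itP k.
by move: sd; rewrite /sufficient_decrease /block_fun /xbar replace_subvec.
Qed.

(** The three terms come from the stopping test, the gradient error of the model and the gradient of
    the regularization. *)
Definition gP_const s := theta + L + sigma_max s * p.+1%:R.

Lemma gP_block_bound s k i : sigma_min <= s -> i \in block r k ->
  `|gP l u f (iterate r k.+1) 0 i| <= gP_const s * step k ^+ p.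
Proof.
move=> smin ik; have [_ _ [_ vt _ _ ->]] := itP k; rewrite stepE.
set z := trial r k (nrej r k); set d := enorm (z - xbar r k).
set sk := sigma r k (nrej r k).
have [bz _ crit] : valid_trial l u p theta sk z by exact: vt.
have [acc _ _] := accurate (leqnn (nrej r k)).
have /andP[sk0 skmax] := sigma_bound smin (leqnn (nrej r k)).
have lub : forall j, subvec (block r k) l 0 j <= subvec (block r k) u 0 j.
  by move=> j; rewrite !mxE; exact: ltW.
have lule i' : l 0 i' <= u 0 i' by exact: ltW.
rewrite -(enum_rankK_in ik ik); set j := enum_rank_in ik i.
have -> : gP l u f (replace (iterate r k) z) 0 (enum_val j) =
    (Defs.proj (block_box l u (k := k)) (z - grad (@block_fun _ _ f r k) z) - z) 0 j.
  have /rowP/(_ j) := proj_grad_replace f (iterate r k) z lule.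
  by rewrite [RHS]mxE => <-.
apply: le_trans (ler_coord_enorm _ _) _.
pose P := Defs.proj (@block_box _ _ l u r k).
(* The projected step of the regularized model is inserted: the stopping test bounds the first part,
   and nonexpansiveness reduces the second to a difference of gradients. *)
have -> : P (z - grad (@block_fun _ _ f r k) z) - z =
    (P (z - grad (@reg_model _ _ r p k sk) z) - z) +
    (P (z - grad (@block_fun _ _ f r k) z) -
     P (z - grad (@reg_model _ _ r p k sk) z)) by rewrite [RHS]addrC addrA subrK.
apply: le_trans (ler_enormD _ _) _.
rewrite /gP_const -addrA mulrDl; apply: lerD; first exact: crit.
apply: le_trans (proj_box_nonexpansive _ _ lub) _.
rewrite grad_reg_model//.
set c := sk * _.
have vecE (y a b v : 'rV[R]_#|block r k|) :
    y - a - (y - (b + v)) = - (a - b) + v.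
  by apply/rowP => ?; rewrite !mxE; ring.
rewrite vecE.
apply: le_trans (ler_enormD _ _) _; rewrite enormN enormZ mulrDl.
apply: lerD; first exact: acc.
have d0 : 0 <= d by exact: enorm_ge0.
rewrite ger0_norm ?mulr_ge0 ?exprn_ge0// /c -!mulrA -exprSr prednK//.
by rewrite ler_wpM2r// mulr_ge0// exprn_ge0.
Qed.

(** When the window of length [m] slides by one, the known occurrence of [i] is lost only if it sits
    at [k] itself; the next one, at most [m] later, is then in the new window. *)
Lemma block_recurs m : essentially_cyclic r m ->
  forall i k, exists2 k', (k <= k' < k + m)%N & i \in block r k'.
Proof.
move=> cyc i; have [[k0 k0m ik0] nxt] := cyc i.
elim=> [|k [k' /andP[kk' k'm] ik']]; first by exists k0.
have [kltk'|] := ltnP k k'.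
  by exists k' => //; rewrite kltk' addSn ltnS ltnW.
move=> k'k; have kE : k' = k by apply/eqP; rewrite eqn_leq k'k.
have [m' /andP[m'1 m'm] im'] := nxt _ ik'.
exists (k' + m')%N => //; rewrite kE addSn ltnS leq_add2l m'm andbT.
by rewrite -addn1 leq_add2l.
Qed.

Lemma iterate_nonincreasing k t : f (iterate r (k + t)) <= f (iterate r k).
Proof.
elim: t => [|t ih]; first by rewrite addn0.
rewrite addnS; apply: le_trans (decrease _) _; apply: le_trans ih.
by rewrite gerBl mulr_ge0 ?exprn_ge0 ?step_ge0// ltW.
Qed.

(** Since [f] never increases along the run, the gain of a single step survives to the end of the
    window. *)
Lemma decrease_from_step k m k' X : (k <= k' < k + m)%N ->
  X <= alpha * step k' ^+ p.+1 ->
  f (iterate r (k + m)) <= f (iterate r k) - X.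
Proof.
move=> /andP[kk' k'm] XA.
have -> : (k + m = k'.+1 + (k + m - k'.+1))%N by rewrite subnKC.
apply: le_trans (iterate_nonincreasing _ _) _.
apply: le_trans (decrease _) _; apply: lerB => //.
by rewrite -(subnKC kk'); exact: iterate_nonincreasing.
Qed.

(** The two iterates are separated by the [t] steps [k + 1, ..., k + t], all in the window because
    [t < m]; the Lipschitz bounds are summed over them. *)
Lemma gP_drift Lg delta k m i t : box l u (iterate r 0) -> 0 <= Lg ->
  (forall (j : 'I_n) (x z : 'rV[R]_n), box l u x -> box l u z ->
     `|gP l u f x 0 j - gP l u f z 0 j| <= Lg * enorm (x - z)) ->
  (forall k', (k <= k' < k + m)%N -> step k' <= delta) -> (t < m)%N ->
  `|gP l u f (iterate r (k + t).+1) 0 i - gP l u f (iterate r k.+1) 0 i|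
    <= Lg * delta *+ t.
Proof.
move=> b0 Lg0 lip small; elim: t => [_|t ih tm].
  by rewrite addn0 subrr normr0.
apply: le_trans (ler_distD (gP l u f (iterate r (k + t).+1) 0 i) _ _) _.
rewrite mulrS; apply: lerD; last exact/ih/ltnW.
apply: le_trans (lip _ _ _ (iterate_box _ b0) (iterate_box _ b0)) _.
apply: ler_wpM2l => //; rewrite addnS; apply: small.
by rewrite -addnS leq_addr ltn_add2l.
Qed.

End Run.

(** * Counting cycles and the complexity bound *)

Lemma powR_le_expr (R : realType) (p : nat) (C d e : R) : (0 < p)%N ->
  0 < C -> 0 <= d -> 0 <= e -> e <= C * d ^+ p ->
  C^-1 `^ (p.+1%:R / p%:R) * e `^ (p.+1%:R / p%:R) <= d ^+ p.+1.
Proof.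
move=> p0 C0 d0 e0 eC; have Ci : 0 <= C^-1 by rewrite invr_ge0 ltW.
have -> : d ^+ p.+1 = (d ^+ p) `^ (p.+1%:R / p%:R).
  rewrite -[in RHS](powR_mulrn p d0) -powRrM mulrC divfK ?pnatr_eq0 -?lt0n//.
  by rewrite powR_mulrn.
rewrite -powRM//; apply: ge0_ler_powR.
- by rewrite divr_ge0.
- by rewrite nnegrE mulr_ge0.
- by rewrite nnegrE exprn_ge0.
by rewrite ler_pdivrMl.
Qed.

(** If no index within the bound works, [a] decreases by [A] and [b] by [B] fit into [G 0 - t]. So
    [a] and [b] are each at most their own quotient, which is why the quotients add up. *)
Lemma good_index_bound (R : realType) (G : nat -> R) (good : nat -> Prop)
    (A B t : R) : 0 < A -> 0 < B -> t <= G 0 ->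
  (forall k, [\/ good k, G k.+1 <= G k - A | G k.+1 <= G k - B]) ->
  exists2 k : nat, k%:R <= (G 0 - t) / A + (G 0 - t) / B + 1 &
    G k <= t \/ good k.
Proof.
move=> A0 B0 tG step; set bnd := _ / A + _ / B.
have bnd0 : 0 <= bnd by rewrite addr_ge0// divr_ge0 ?subr_ge0// ltW.
have [[k kb gk]|none] :=
  pselect (exists2 k : nat, k%:R <= bnd + 1 & G k <= t \/ good k).
  by exists k.
have bad (k : nat) : k%:R <= bnd + 1 -> t < G k /\ ~ good k.
  move=> kb; split; last by move=> gk; apply: none; exists k => //; right.
  by rewrite ltNge; apply/negP => Gk; apply: none; exists k => //; left.
have count (k : nat) : k%:R <= bnd + 1 ->
    exists a b, (a + b = k)%N /\ G k <= G 0 - (A *+ a + B *+ b).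
  elim: k => [|k ih] kb; first by exists 0, 0; rewrite !mulr0n addr0 subr0.
  have kb' : k%:R <= bnd + 1 by apply: le_trans kb; rewrite ler_nat.
  have [a [b [abk Gk]]] := ih kb'; have [_ ng] := bad _ kb'.
  case: (step k) => [//|GS|GS]; [exists a.+1, b|exists a, b.+1].
    by rewrite addSn abk mulrS; split => //; apply: le_trans GS _; lra.
  by rewrite addnS abk mulrS; split => //; apply: le_trans GS _; lra.
(* [N] is the last index within the bound, so [bnd < N]; the count below gives [N <= bnd]. *)
pose N := Num.trunc (bnd + 1).
have /andP[Nb bN] := truncn_itv (addr_ge0 bnd0 ler01).
have [a [b [abN GN]]] := count N Nb; have [tN _] := bad N Nb.
suff : N%:R <= bnd.
  by move: bN; rewrite -/N -[N.+1]addn1 natrD ltrD2r => bN /le_lt_trans/(_ bN);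
    rewrite ltxx.
have Aa : 0 <= A *+ a by rewrite mulrn_wge0// ltW.
have Bb : 0 <= B *+ b by rewrite mulrn_wge0// ltW.
rewrite -abN natrD; apply: lerD; rewrite ler_pdivlMr// mulr_natl; lra.
Qed.

(* The constant [c] is independent of [sigma_min] only as long as [sigma_min]
   stays below a bound [s]: without such a bound the claim fails, since a huge
   [sigma_min] forces arbitrarily short steps. With [s := tau2 * (L + alpha)],
   [c] depends on [alpha], [tau2], [L], [p], [theta] only. *)
Theorem theorem5p8 (R : realType) (p : nat) (alpha tau2 L theta s : R)
    (p_gt0 : (0 < p)%N) (alpha_gt0 : 0 < alpha) (tau2_gt1 : 1 < tau2)
    (L_gt0 : 0 < L) (theta_gt0 : 0 < theta) :
  exists2 c : R, 0 < c &
  forall (n : nat) (l u : 'rV[R]_n) (f : 'rV[R]_n -> R)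
    (sigma_min tau1 : R) (x0 : 'rV[R]_n) (r : cd_run R n)
    (m : nat) (Lg ftarget eps : R),
  (forall i, l 0 i < u 0 i) ->
  continuous_first_derivatives (box l u) f ->
  0 < sigma_min -> sigma_min <= s ->
  1 < tau1 -> tau1 <= tau2 ->
  generated f l u r p alpha sigma_min tau1 tau2 theta x0 ->
  model_accuracy f r p L ->
  (0 < m)%N -> essentially_cyclic r m ->
  0 < Lg ->
  (forall (i : 'I_n) (x z : 'rV[R]_n), box l u x -> box l u z ->
     `|gP l u f x 0 i - gP l u f z 0 i| <= Lg * enorm (x - z)) ->
  ftarget <= f x0 -> 0 < eps ->
  exists2 cycle : nat,
    cycle%:R <= (f x0 - ftarget) / (c * (eps / 2) `^ (p.+1%:R / p%:R))
                + (f x0 - ftarget) / (alpha * (eps / (2 * m%:R * Lg)) ^+ p.+1)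
                + 1 &
    let k := (cycle * m)%N in
    f (iterate r k) <= ftarget \/
    forall i : 'I_n, `|gP l u f (iterate r k.+1) 0 i| <= eps.
Proof.
pose C := gP_const p alpha tau2 theta L s.
(* The factor [alpha] comes from sufficient decrease, the power of [C^-1] from solving
   [eps / 2 <= C * d ^+ p] for [d ^+ p.+1]. *)
pose c := alpha * C^-1 `^ (p.+1%:R / p%:R).
have C0 : 0 < C.
  apply: ltr_wpDr; last exact: addr_gt0.
  rewrite mulr_ge0// le_max; apply/orP; right.
  by rewrite mulr_ge0 ?addr_ge0 ?ltW// (lt_trans _ tau2_gt1).
exists c; first by rewrite mulr_gt0// powR_gt0// invr_gt0.
move=> n l u f sigma_min tau1 x0 r m Lg ftarget eps lu _ smin0 smins tau1_gt1
  tau12 [bx0 it0 itP] acc m0 cyc Lg0 lip fx0 eps0.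
set A := c * _; set delta := eps / (2 * m%:R * Lg); set B := alpha * _.
have mR0 : 0 < m%:R :> R by rewrite ltr0n.
have delta0 : 0 < delta by rewrite divr_gt0// !mulr_gt0.
have A0 : 0 < A by rewrite !mulr_gt0 ?powR_gt0 ?invr_gt0 ?divr_gt0.
have B0 : 0 < B by rewrite mulr_gt0// exprn_gt0.
have b0 : box l u (iterate r 0) by rewrite it0.
pose G k := f (iterate r (k * m)).
have G0 : G 0%N = f x0 by rewrite /G mul0n it0.
rewrite -G0 in fx0 *.
apply: (good_index_bound A0 B0 fx0) => k.
have [good|/existsNP[i]] := pselect (forall i : 'I_n,
  `|gP l u f (iterate r (k * m).+1) 0 i| <= eps); first exact: Or31.
move/negP; rewrite -ltNge => bad.
rewrite /G mulSnr.
have [[k' kk' dk']|small] := pselect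
  (exists2 k', (k * m <= k' < k * m + m)%N & delta < step r k').
  apply: Or33; apply: (decrease_from_step alpha_gt0 itP kk').
  by rewrite ler_pM2l// lerXn2r ?nnegrE ?step_ge0 ?ltW.
have {}small k' : (k * m <= k' < k * m + m)%N -> step r k' <= delta.
  by move=> kk'; rewrite leNgt; apply/negP => dk'; apply: small; exists k'.
have [k' kk' ik'] := block_recurs cyc i (k * m).
apply: Or32; apply: (decrease_from_step alpha_gt0 itP kk').
have /andP[k1 k2] := kk'.
have tm : (k' - k * m < m)%N by rewrite ltn_subLR.
have := gP_drift itP i b0 (ltW Lg0) lip small tm; rewrite subnKC// => drift.
(* The value of [delta] makes [m] drifts of size [Lg * delta] sum to exactly [eps / 2]. *)
have drift2 : Lg * delta *+ (k' - k * m) <= eps / 2.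
  apply: (@le_trans _ _ (Lg * delta *+ m)).
    rewrite -[leLHS]mulr_natr -[leRHS]mulr_natr; apply: ler_wpM2l.
      by rewrite mulr_ge0 ?ltW.
    by rewrite ler_nat ltnW.
  rewrite -mulr_natr /delta le_eqVlt; apply/orP; left; apply/eqP.
  by field; rewrite !gt_eqF.
(* Component [i] exceeds [eps] after the first iteration of the cycle, so after iteration [k'] it is
   still above [eps / 2] in absolute value. *)
have eC : eps / 2 <= C * step r k' ^+ p.
  apply: le_trans (gP_block_bound p_gt0 alpha_gt0 L_gt0 lu smin0 tau1_gt1
    tau12 itP acc smins ik').
  have := ler_distD (gP l u f (iterate r k'.+1) 0 i)
    (gP l u f (iterate r (k * m).+1) 0 i) 0.
  rewrite !subr0 distrC; lra.
rewrite /A /c -mulrA ler_pM2l//.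
by apply: powR_le_expr => //; rewrite ?step_ge0// divr_ge0// ltW.
Qed.
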